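(* For any integer $d\ge 2$, any $n>0$ and any $0<\alpha<1$, there exists an $\alpha$-edit-distance tree code $C:\Sigma_{in}^n\to\Sigma_{out}^n$ of depth $n$ with $|\Sigma_{in}|=d$ and $|\Sigma_{out}|=(176\cdot d)^{4/(1-\alpha)}$.
   Context: For a string $s$, $s[i]$ is its $i$-th symbol and $s[i..j]=s[i]\circ\cdots\circ s[j]$. A string matching between strings $sm$ and $rm$ (over an alphabet not containing the special symbol $*$) is a pair $\tau=(\tau_1,\tau_2)$ with $|\tau_1|=|\tau_2|$, such that deleting all $*$'s from $\tau_1$ gives $sm$, deleting all $*$'s from $\tau_2$ gives $rm$, and for each $i$ either $\tau_1[i]=\tau_2[i]$ or one of them is $*$. Let $sc(\cdot)$ denote the number of $*$'s in a string. The edit distance is $ED(sm,rm)=\min_{\tau} sc(\tau_1)+sc(\tau_2)$ over string matchings $\tau$ between $sm$ and $rm$ (i.e., the minimum number of insertions plus deletions). A prefix code $C:\Sigma_{in}^n\to\Sigma_{out}^n$ is a map such that $C(x)[i]$ depends only on $x[1..i]$; equivalently, a $|\Sigma_{in}|$-ary tree of depth $n$ whose edges are labeled by symbols of $\Sigma_{out}$, where the root-to-node path indexed by $x\in\Sigma_{in}^l$ has deepest edge labeled $C(x)[l]$. For tree nodes $U,V$ with $U$ an ancestor of $V$, $UV$ denotes the string of labels along the tree path from $U$ to $V$. $C$ contains an $\alpha$-bad lambda if there are tree nodes $A,B,D,E$ such that $B\ne D$, $B\ne E$, $B$ is a common ancestor of $D$ and $E$, $A$ is an ancestor of $B$ or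 $A=B$, and $ED(AD,BE)\le\alpha\cdot\max(|AD|,|BE|)$. $C$ is an $\alpha$-edit-distance tree code if it contains no $\alpha$-bad lambda.
   Formalization: In a bad lambda, B is taken to be the lowest common ancestor of D and E (with any common ancestor, A=B, D=E gives edit distance 0 and no code exists), and the output alphabet size is the integer part of (176d)^{4/(1-α)}. *)

(* Defs.v *)
From mathcomp Require Import all_boot all_order all_algebra.
From mathcomp Require Import boolp reals exp.

Set Implicit Arguments.
Unset Strict Implicit.
Unset Printing Implicit Defensive.

Import Order.TTheory GRing.Theory Num.Theory.

(* Strings over T extended with the special symbol * are of type
   seq (option T): None is *, and Some c is the symbol c. *)

Section EditDistance.

Variable T : eqType.
Implicit Types (sm rm : seq T) (tau : seq (option T)).

Definition del_stars tau : seq T := pmap id tau.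

Definition sc tau : nat := count_mem None tau.

Definition string_matching sm rm tau1 tau2 : Prop :=
  [/\ size tau1 = size tau2,
      del_stars tau1 = sm,
      del_stars tau2 = rm
    & forall i, i < size tau1 ->
        [\/ nth None tau1 i = nth None tau2 i,
            nth None tau1 i = None
          | nth None tau2 i = None]].

Definition matching_cost sm rm (k : nat) : Prop :=
  exists tau1 tau2, string_matching sm rm tau1 tau2 /\ sc tau1 + sc tau2 = k.

Lemma matching_cost_ex sm rm : exists k, `[< matching_cost sm rm k >].
Proof.
pose tau1 := map Some sm ++ nseq (size rm) None.
pose tau2 := nseq (size sm) None ++ map Some rm.
exists (sc tau1 + sc tau2); apply/asboolP; exists tau1, tau2; split=> //.
have delS s : del_stars (map Some s) = s.
  by rewrite /del_stars; elim: s => //= x s ->.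
have delN m : del_stars (nseq m None) = [::] by elim: m.
split.
- by rewrite !size_cat !size_map !size_nseq.
- by rewrite /del_stars pmap_cat -!/(del_stars _) delS delN cats0.
- by rewrite /del_stars pmap_cat -!/(del_stars _) delS delN.
- move=> i _; rewrite !nth_cat size_map size_nseq.
  by case: ifP => _; [apply: Or33 | apply: Or32]; rewrite nth_nseq if_same.
Qed.

Definition ED sm rm : nat := ex_minn (matching_cost_ex sm rm).

End EditDistance.

(* A node of the complete |Sin|-ary tree of depth n is the string of input
   symbols, of size at most n, leading to it from the root [::].  U is V or an
   ancestor of V iff U is a prefix of V, and a leaf is an n.-tuple. *)

Section TreeCodes.

Variables (n : nat) (Sin Sout : finType).
Implicit Types (C : n.-tuple Sin -> n.-tuple Sout) (A B D E U V : seq Sin).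

Definition prefix_code C : Prop :=
  forall (x y : n.-tuple Sin) (i : 'I_n),
    take i.+1 x = take i.+1 y -> tnth (C x) i = tnth (C y) i.

(* The labels met from U down to V are the symbols |U|+1, ..., |V| of C x for
   any leaf x below V; for a prefix code the choice of x is immaterial
   (path_labelE). The value [::] is only taken when no leaf is below V. *)
Definition path_label C U V : seq Sout :=
  if [pick x : n.-tuple Sin | prefix V x] is Some x
  then drop (size U) (take (size V) (C x))
  else [::].

Lemma path_labelE C U V (x : n.-tuple Sin) :
  prefix_code C -> prefix V x ->
  path_label C U V = drop (size U) (take (size V) (C x)).
Proof.
move=> Cpre Vx; rewrite /path_label; case: pickP => [y Vy|/(_ x)]; last first.
  by rewrite Vx.
have le_Vn : size V <= n by rewrite -(size_tuple x) size_prefix.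
congr drop; case: (posnP (size V)) => [->|V_gt0]; first by rewrite !take0.
pose s0 := tnth (C x) (Ordinal (leq_trans V_gt0 le_Vn)).
apply: (@eq_from_nth _ s0); first by rewrite !size_takel ?size_tuple.
move=> i; rewrite size_takel ?size_tuple // => lt_iV.
have lt_in : i < n := leq_trans lt_iV le_Vn.
rewrite !nth_take //.
have := Cpre y x (Ordinal lt_in); rewrite !(tnth_nth s0) /=.
move: Vx Vy => /prefixP[s1 ->] /prefixP[s2 ->].
by apply; rewrite !takel_cat.
Qed.

(* D and E branch off exactly at B: B is a common ancestor of D and E, and no
   common ancestor of D and E lies strictly below B. Without the second
   condition D = E would be allowed, so that A = B, D = E would make a bad
   lambda in every code of positive depth, as ED(BD, BD) = 0. *)
Definition meet_at B D E : Prop :=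
  [/\ prefix B D, prefix B E
    & forall F : seq Sin, prefix F D -> prefix F E -> prefix F B].

Local Open Scope ring_scope.

Definition bad_lambda (R : realType) (alpha : R) C : Prop :=
  exists A B D E : seq Sin,
    [/\ (size D <= n)%N /\ (size E <= n)%N,
        B <> D /\ B <> E,
        meet_at B D E,
        prefix A B
      & (ED (path_label C A D) (path_label C B E))%:R <=
        alpha * (maxn (size (path_label C A D))
                      (size (path_label C B E)))%:R].

Definition edit_distance_tree_code (R : realType) (alpha : R) C : Prop :=
  prefix_code C /\ ~ bad_lambda alpha C.

End TreeCodes.

(* Main.v *)
(* Label every edge of the tree independently. The paths AD and BE of a lambda
   share no edge, so once a partial matching between them is fixed, the labels
   at the matched positions of BE are determined by all the other labels. A bad
   lambda with |AD| = p and |BE| = r has a common subsequence of length l with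
   4 l >= (1 - alpha)(p + r), hence each such event has "probability" q^-l,
   roughly (88 d)^-(p + r), whereas an edge lies on about d^(p + r) lambdas of
   that size. A counting form of the local lemma, due to Rosenfeld, concludes:
   by induction on a set X of edges, allowing one more edge to be part of the
   forbidden events keeps at least half of the labellings that are good on X. *)

Require Import Defs.
From mathcomp Require Import all_boot all_order all_algebra.
From mathcomp Require Import boolp reals exp.
From mathcomp Require Import ring lra zify.

Set Implicit Arguments.
Unset Strict Implicit.
Unset Printing Implicit Defensive.

Import Order.TTheory GRing.Theory Num.Theory.

Local Open Scope ring_scope.

(** * A counting local lemma for events that determine some of the labels *)

Section AvoidEvents.

Variables (R : realFieldType) (V S I : finType).
Variables (P : pred I) (supp T : I -> {set V}) (bad : I -> pred {ffun V -> S}).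
Implicit Types (f g : {ffun V -> S}) (X Y : {set V}).

Hypothesis bad_supp : forall i f g,
  P i -> {in supp i, f =1 g} -> bad i f -> bad i g.
Hypothesis bad_det : forall i f g,
  P i -> {in ~: T i, f =1 g} -> bad i f -> bad i g -> f = g.

(** Members label all of [V], with only the events supported in [X] forbidden, so the cardinals for
    different [X] compare without normalization. *)
Definition avoiding X : {set {ffun V -> S}} :=
  [set f | [forall i, P i && (supp i \subset X) ==> ~~ bad i f]].

Lemma avoidingP X f :
  reflect (forall i, P i -> supp i \subset X -> ~~ bad i f) (f \in avoiding X).
Proof.
rewrite inE; apply: (iffP forallP) => [h i Pi sX | h i].
  by have := h i; rewrite Pi sX.
by apply/implyP => /andP[Pi sX]; apply: h.
Qed.

Lemma avoidingS X Y : X \subset Y -> avoiding Y \subset avoiding X.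
Proof.
move=> XY; apply/subsetP => f /avoidingP h; apply/avoidingP => i Pi sX.
exact: h Pi (subset_trans sX XY).
Qed.

Lemma avoiding_eq X f g : {in X, f =1 g} -> f \in avoiding X -> g \in avoiding X.
Proof.
move=> fg /avoidingP h; apply/avoidingP => i Pi sX.
apply: contra (h i Pi sX); apply: bad_supp => // v /(subsetP sX) vX.
by rewrite fg.
Qed.

(* The labels on [T i] can be rerandomized freely without leaving
   [avoiding (X :\: T i)], whereas the event determines them. *)
Lemma card_bad_avoiding X i : P i ->
  (#|[set f in avoiding X | bad i f]| * #|S| ^ #|T i|
     <= #|avoiding (X :\: T i)|)%N.
Proof.
move=> Pi; set B := [set f in _ | _].
have [->|[f0 f0B]] := set_0Vmem B; first by rewrite cards0.
(* An empty [T i] is treated apart, since a point of [T i] is used to produce the default label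
   [s0]. *)
case: (posnP #|T i|) => [T0|T_gt0].
  rewrite T0 expn0 muln1; apply/subset_leq_card.
  apply: subset_trans (avoidingS (subsetDl X (T i))).
  by apply/subsetP => f; rewrite inE => /andP[].
have [v0 _] : {v0 | v0 \in T i} by apply/sigW/card_gt0P.
pose s0 := f0 v0.
(* [H] holds the relabellings of [T i], made unique by the value [s0] elsewhere; [ov] overwrites a
   bad labelling with one of them. *)
pose H : {set {ffun V -> S}} := [set h in pffun_on s0 (T i) predT].
pose ov (p : {ffun V -> S} * {ffun V -> S}) : {ffun V -> S} :=
  [ffun v => if v \in T i then p.2 v else p.1 v].
have <- : #|setX B H| = (#|B| * #|S| ^ #|T i|)%N.
  have -> : (#|S| ^ #|T i| = #|H|)%N by rewrite cardsE card_pffun_on.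
  by rewrite cardsX.
rewrite -(card_in_imset (f := ov)).
  apply/subset_leq_card/subsetP => _ /imsetP[[f h] /setXP[fB hH] ->] /=.
  move: fB; rewrite inE => /andP[fX _].
  apply: (@avoiding_eq _ f); last exact: (subsetP (avoidingS (subsetDl _ _))).
  by move=> v; rewrite inE ffunE /= => /andP[/negbTE->].
move=> [f h] [g k] /setXP[/= fB hH] /setXP[/= gB kH] /ffunP e.
have fg : f = g.
  move: fB gB; rewrite !inE => /andP[_ bf] /andP[_ bg].
  apply: (bad_det Pi _ bf bg) => v; rewrite inE => /negbTE vT.
  by have := e v; rewrite !ffunE /= vT.
congr pair => //; apply/ffunP => v; have := e v; rewrite !ffunE /=.
case: ifPn => // vT _.
move: hH kH; rewrite !inE => /pffun_onP[/supportP h0 _] /pffun_onP[/supportP k0 _].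
by rewrite h0 // k0.
Qed.

Variable c : R.
Hypothesis c01 : 0 < c <= 1.

(** The points of [Y] that lie in [X] are put back one by one, each at the cost of a factor [c]; the
    others are harmless as [c <= 1]. The step is assumed only below [#|X|], so that it can serve as
    an induction hypothesis. *)
Lemma card_avoiding_setD X Y :
  (forall (Z : {set V}) e, (#|Z| < #|X|)%N -> e \notin Z ->
     c * #|avoiding Z|%:R <= #|avoiding (e |: Z)|%:R) ->
  c ^+ #|Y| * #|avoiding (X :\: Y)|%:R <= #|avoiding X|%:R :> R.
Proof.
case/andP: c01 => c0 c1.
elim: {Y}_.+1 {-2}Y (ltnSn #|Y|) X => // m IH Y Ym X step.
case: (set_0Vmem (Y :&: X)) => [YX0|[x /setIP[xY xX]]].
  rewrite [X :\: Y](setDidPl _); last by rewrite disjoint_sym -setI_eq0 YX0.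
  by rewrite ler_piMl // exprn_ile1 // ltW.
have cX : #|X| = #|X :\ x|.+1 by rewrite (cardsD1 x X) xX.
have cY : #|Y| = #|Y :\ x|.+1 by rewrite (cardsD1 x Y) xY.
have -> : X :\: Y = (X :\ x) :\: (Y :\ x).
  apply/setP => v; rewrite !inE; case: (eqVneq v x) => [->|//].
  by rewrite xY.
rewrite cY exprS -mulrA; apply: le_trans (ler_wpM2l (ltW c0) _) _.
- apply: IH => [|Z e Zx]; first by rewrite -ltnS -cY.
  by apply: step; rewrite cX ltnS ltnW.
- by rewrite -{2}(setD1K xX) step ?cX // !inE eqxx.
Qed.

Hypothesis S_gt0 : (0 < #|S|)%N.
(** The local lemma condition: [#|S|^-1] per determined label, times [c^-1] for putting that point
    back into the set. *)
Hypothesis sum_supp : forall e,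
  \sum_(i | P i && (e \in supp i)) ((c * #|S|%:R)^-1) ^+ #|T i| <= 1 - c.

(** A labelling lost when [e] is added satisfies an event whose support contains [e]; by [sum_supp]
    such events take at most the fraction [1 - c]. *)
Lemma card_avoiding_setU1 X e : e \notin X ->
  c * #|avoiding X|%:R <= #|avoiding (e |: X)|%:R :> R.
Proof.
case/andP: (c01) => c0 c1.
elim: {X}_.+1 {-2}X (ltnSn #|X|) e => // m IH X Xm e eX.
pose B i := [set f in avoiding X | bad i f].
have Ble i : P i ->
  #|B i|%:R <= ((c * #|S|%:R)^-1) ^+ #|T i| * #|avoiding X|%:R :> R.
  move=> Pi; rewrite exprVn mulrC ler_pdivlMr ?exprn_gt0 ?mulr_gt0 ?ltr0n //.
  apply: le_trans (@card_avoiding_setD X (T i) _); last first.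
    by move=> Z x ZX; apply: IH; apply: leq_trans ZX _; rewrite -ltnS.
  rewrite exprMn mulrCA; apply: ler_wpM2l; first exact/exprn_ge0/ltW.
  by rewrite -natrX -natrM ler_nat card_bad_avoiding.
have cover : #|avoiding X|%:R <=
    #|avoiding (e |: X)|%:R + \sum_(i | P i && (e \in supp i)) #|B i|%:R :> R.
  rewrite -natr_sum -natrD. rewrite ler_nat.
  apply: leq_trans (leq_add (leqnn _) (_ : #|\bigcup_(i | P i && (e \in supp i)) B i| <= _)%N); last first.
    elim/big_rec2: _ => [|i n A _ le]; first by rewrite cards0.
    by rewrite (leq_trans (leq_card_setU _ _)) // leq_add2l.
  rewrite (leq_trans _ (leq_card_setU _ _)) //; apply/subset_leq_card/subsetP.
  move=> f fX; rewrite inE; case: (boolP (f \in avoiding (e |: X))) => //= /negP fn.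
  have /existsP[i] : [exists i, [&& P i, supp i \subset e |: X & bad i f]].
    apply: contraT; rewrite negb_exists => /forallP h; case: fn.
    by apply/avoidingP => i Pi sX; have := h i; rewrite Pi sX.
  case/and3P => Pi sX bf; apply/bigcupP; exists i; last by rewrite inE fX.
  rewrite Pi; apply: contraT => /= ei; case/negP: (fn).
  move/avoidingP: fX => /(_ i Pi) /implyP; rewrite bf implybF => /negP[].
  apply/subsetP => v vs; have := subsetP sX v vs; rewrite !inE => /predU1P[ve|//].
  by rewrite -ve vs in ei.
have : \sum_(i | P i && (e \in supp i)) #|B i|%:R <= (1 - c) * #|avoiding X|%:R :> R.
  apply: le_trans (ler_wpM2r (ler0n _ _) (sum_supp e)); rewrite mulr_suml.
  by apply: ler_sum => i /andP[Pi _]; apply: Ble.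
move: cover; lra.
Qed.

Lemma exists_avoiding : (forall i, P i -> supp i != set0) ->
  exists f : {ffun V -> S}, forall i, P i -> ~~ bad i f.
Proof.
move=> supp0; have /card_gt0P[f /avoidingP fV] : (0 < #|avoiding setT|)%N; last first.
  by exists f => i Pi; apply: fV (subsetT _).
(* No support is empty, so every labelling lies in [avoiding set0]; going up to [setT] costs
   [c ^+ #|V|]. *)
rewrite -(ltr0n R); apply: lt_le_trans (@card_avoiding_setD setT setT _).
  rewrite mulr_gt0 ?exprn_gt0 //; first by case/andP: c01.
  rewrite ltr0n setDv; have /card_gt0P[s _] := S_gt0.
  apply/card_gt0P; exists [ffun=> s]; apply/avoidingP => i Pi.
  by rewrite subset0 (negbTE (supp0 i Pi)).
by move=> Z e _; apply: card_avoiding_setU1.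
Qed.

End AvoidEvents.

(** * Geometric sums over words, and a count of nearby ancestors *)

Section WordSums.

Variables (R : realFieldType) (T : finType) (n : nat) (t x : R).
Hypotheses (t0 : 0 <= t) (tx : #|T|%:R * t <= x) (x1 : x < 1).

Lemma card_bseq_size (k : nat) : (#|[pred u : n.-bseq T | size u == k]| <= #|T| ^ k)%N.
Proof.
rewrite -card_tuple.
(* A letter [a] serves as default for [nth]; over an empty alphabet only the empty word is left. *)
case: (pickP T) => [a _|T0].
  rewrite -(card_in_imset (f := fun u : n.-bseq T => [tuple nth a u i | i < k])).
    exact: max_card.
  move=> u v; rewrite !inE => /eqP su /eqP sv e; apply: val_inj.
  apply: (@eq_from_nth _ a) => [|i]; first by rewrite su sv.
  by rewrite su => ik; have := congr1 (fun w : k.-tuple T => tnth w (Ordinal ik)) e; rewrite !tnth_mktuple.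
case: k => [|k].
  rewrite -(card_in_imset (f := fun=> [tuple] : 0.-tuple T)); first exact: max_card.
  move=> u v; rewrite !inE => /nilP u0 /nilP v0 _; apply: val_inj.
  by rewrite /= u0 v0.
rewrite eq_card0 // => u; rewrite !inE; apply/negP.
by case: u => -[|a u] ? //; have := T0 a.
Qed.

Lemma sum_bseq_size_from m :
  \sum_(u : n.-bseq T | (m <= size u)%N) t ^+ size u <= x ^+ m / (1 - x).
Proof.
have Tt0 : 0 <= #|T|%:R * t by rewrite mulr_ge0.
have x0 : 0 <= x := le_trans Tt0 tx.
have le_k k : \sum_(u : n.-bseq T | (m <= size u)%N && (size u == k)) t ^+ size u
    <= if (m <= k)%N then x ^+ k else 0.
  case: ifP => mk; last by rewrite big1 // => u /andP[+ /eqP e]; rewrite e mk.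
  rewrite (eq_bigr (fun=> t ^+ k)) => [|u /andP[_ /eqP->] //].
  rewrite sumr_const -[_ *+ _]mulr_natl.
  apply: (@le_trans _ _ ((#|T| ^ k)%N%:R * t ^+ k)).
    apply: ler_wpM2r; first exact: exprn_ge0.
    rewrite ler_nat (leq_trans _ (card_bseq_size k)) //.
    by apply/subset_leq_card/subsetP => u; rewrite !inE => /andP[].
  by rewrite natrX -exprMn lerXn2r.
rewrite (partition_big (fun u : n.-bseq T => inord (size u) : 'I_n.+1) predT) //=.
apply: (@le_trans _ _ (\sum_(k < n.+1) if (m <= k)%N then x ^+ k else 0)).
  apply: ler_sum => k _; apply: le_trans (le_k k); rewrite le_eqVlt; apply/orP; left.
  apply/eqP/eq_bigl => u; congr andb; rewrite -val_eqE /= inordK //.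
  by rewrite ltnS size_bseq.
rewrite ler_pdivlMr ?subr_gt0 //.
(* The product with [1 - x] telescopes; [maxn] covers the range [N <= m], where the sum is still
   empty. *)
suff : forall N, (\sum_(k < N) if (m <= k)%N then x ^+ k else 0) * (1 - x)
   <= x ^+ m - x ^+ (maxn m N).
  by move/(_ n.+1) => h; apply: le_trans h _; rewrite gerBl exprn_ge0.
elim=> [|N IH]; first by rewrite big_ord0 mul0r maxn0 subrr.
rewrite big_ord_recr /= mulrDl; apply: le_trans (lerD IH (lexx _)) _.
case: ifPn => mN; last by move: mN; rewrite -ltnNge => mN; rewrite mul0r addr0 (maxn_idPl (ltnW mN)) (maxn_idPl mN).
rewrite (maxn_idPr mN) (maxn_idPr (leqW mN)) mulrBr mulr1 -exprSr.
by rewrite addrA subrK.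
Qed.

End WordSums.

(** An ancestor is determined by its distance to [e], which leaves at most [s + 1] choices; the
    weaker [2 ^ s] can be shared out among the letters of a lambda. *)
Lemma card_prefix_close (T : finType) n (e : seq T) s :
  (#|[pred A : n.-bseq T | prefix A e && (size e <= size A + s)%N]| <= 2 ^ s)%N.
Proof.
apply: leq_trans (ltn_expl s (leqnn 2)).
rewrite -[s.+1]card_ord.
rewrite -(card_in_imset (f := fun A : n.-bseq T => inord (size e - size A) : 'I_s.+1)).
  exact: max_card.
move=> A B; rewrite !inE => /andP[pA lA] /andP[pB lB] /(congr1 val).
rewrite /= !inordK; try by rewrite ltnS leq_subLR.
move=> eAB; apply: val_inj => /=.
have sAB : size A = size B.
  by rewrite -(subKn (size_prefix pA)) eAB subKn // size_prefix.
by move: pA pB; rewrite !prefixE => /eqP eA /eqP eB; rewrite -eA sAB eB.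
Qed.

(** * The size of the output alphabet *)

Lemma powR_truncn_le (R : realType) (d l s : nat) (alpha : R) :
  (0 < d)%N -> 0 < alpha < 1 -> (1 - alpha) * s%:R <= 4 * l%:R ->
  (88 * d%:R) ^+ s <=
    (2^-1 * (Num.truncn ((176 * d%:R) `^ (4 / (1 - alpha)) : R))%:R) ^+ l :> R.
Proof.
move=> d0 /andP[a0 a1] sl; set r := 4 / (1 - alpha); set Q := _ `^ _.
have d1 : 1 <= d%:R :> R by rewrite ler1n.
have b1 : 1 <= 88 * d%:R :> R by lra.
have ia : 0 < 1 - alpha by rewrite subr_gt0.
have r4 : 4 <= r by rewrite /r ler_pdivlMr //; lra.
have Qe : Q = 2 `^ r * (88 * d%:R) `^ r.
  by rewrite -powRM ?(le_trans ler01 b1) //; congr powR; lra.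
have B1 : 1 <= (88 * d%:R) `^ r.
  by rewrite -[leLHS](powRr0 (88 * d%:R)) ler_powR //; lra.
(* Splitting [176] as [2 * 88] leaves a factor of at least 16, which absorbs both the [2^-1] and the
   truncation. *)
have r16 : 16 <= 2 `^ r.
  apply: (@le_trans _ _ (2 `^ 4%:R)); last by apply: ler_powR; lra.
  by rewrite powR_mulrn // ; lra.
have QB : 16 * (88 * d%:R) `^ r <= Q by rewrite Qe ler_wpM2r // powR_ge0.
have Qq : Q < (Num.truncn Q)%:R + 1 by rewrite natr1 truncnS_gt.
have qB : (88 * d%:R) `^ r <= 2^-1 * (Num.truncn Q)%:R by lra.
have B0 := powR_ge0 (88 * d%:R) r.
have q0 := le_trans B0 qB.
(* The base is at least 1, so it remains to compare exponents: [s <= r * l] is the hypothesis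
   [sl]. *)
apply: le_trans (_ : ((88 * d%:R) `^ r) ^+ l <= _); last by rewrite lerXn2r.
rewrite -powR_mulrn ?(le_trans ler01 b1) // -powR_mulrn // -powRrM ler_powR //.
by rewrite /r mulrAC ler_pdivlMr // mulrC.
Qed.

(** * Common subsequences read off a string matching *)

Lemma string_matching_masks (T : eqType) (sm rm : seq T) tau1 tau2 :
  string_matching sm rm tau1 tau2 ->
  exists m1 m2 : bitseq,
    [/\ size m1 = size sm, size m2 = size rm, mask m1 sm = mask m2 rm
      & (size sm + size rm <= 2 * count id m2 + (sc tau1 + sc tau2))%N].
Proof.
elim: tau1 tau2 sm rm => [|a tau1 IH] [|b tau2] sm rm [] //=.
  by move=> _ <- <- _; exists [::], [::].
move=> [e] <- <- h.
have {}IH := IH tau2 _ _ (And4 e erefl erefl (fun i => h i.+1)).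
have := h 0%N isT; case: IH => m1 [m2 [s1 s2 em le]] /=.
move: le; rewrite /sc /del_stars /=.
(* A column of two symbols adds 2 to both sides of the bound, one with a single star adds 1; a
   column of two stars adds only to the cost, hence the inequality. *)
case: a {h} => [a|]; case: b => [b|] /= le h.
- have ab : a = b by case: h => // -[].
  exists (true :: m1), (true :: m2); rewrite /= s1 s2 em ab; split=> //; lia.
- exists (false :: m1), m2; rewrite /= s1 s2 em; split=> //; lia.
- exists m1, (false :: m2); rewrite /= s1 s2 em; split=> //; lia.
- exists m1, m2; split=> //; lia.
Qed.

(** * Edges of tree paths *)

Section TreePaths.

Variable T : finType.
Implicit Types U V s : seq T.

(* An edge is named by its lower endpoint. *)
Definition path_edges U V : seq (seq T) :=
  [seq take j.+1 V | j <- iota (size U) (size V - size U)].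

Lemma size_path_edges U V : size (path_edges U V) = (size V - size U)%N.
Proof. by rewrite size_map size_iota. Qed.

Lemma mem_path_edges U V s : s \in path_edges U V ->
  prefix s V /\ (size U < size s <= size V)%N.
Proof.
case/mapP => j; rewrite mem_iota => /andP[Uj jV] ->; split.
  exact: prefix_take.
by rewrite size_take_min; lia.
Qed.

Lemma path_edges_uniq U V : uniq (path_edges U V).
Proof.
have size_takeS (j : nat) : j \in iota (size U) (size V - size U) ->
    size (take j.+1 V) = j.+1.
  by rewrite mem_iota => jV; rewrite size_takel //; lia.
rewrite map_inj_in_uniq ?iota_uniq // => i j /size_takeS si /size_takeS sj.
by move/(congr1 size); rewrite si sj => -[].
Qed.

(** The lower endpoint of a shared edge would be a common ancestor of [D] and [E], hence not below
    [B], whereas the edges of [BE] end strictly below [B]. *)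
Lemma path_edges_meet A B D E s :
  meet_at B D E -> s \in path_edges A D -> s \notin path_edges B E.
Proof.
move=> [_ _ meet] /mem_path_edges[sD _]; apply/negP => /mem_path_edges[sE].
by rewrite ltnNge (size_prefix (meet s sD sE)).
Qed.

End TreePaths.

(** * Prefix codes from edge labellings *)

Section Labellings.

Variables (n : nat) (Sin Sout : finType).
Implicit Types (f g : {ffun n.-bseq Sin -> Sout}) (U V s : seq Sin).

(** A string longer than [n] takes the label of a default node, which makes [label] total. *)
Definition label f s : Sout := f (insub_bseq n s).

Definition labelling_code f (x : n.-tuple Sin) : n.-tuple Sout :=
  [tuple label f (take i.+1 x) | i < n].

Lemma labelling_code_prefix f : prefix_code (labelling_code f).
Proof. by move=> x y i e; rewrite !tnth_mktuple e. Qed.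

Lemma path_label_code f U V (a : Sin) : (size V <= n)%N ->
  path_label (labelling_code f) U V = map (label f) (path_edges U V).
Proof.
(* Padding [V] with [a] gives a leaf below it, on which the labels can be read. *)
move=> Vn; have xn : size (V ++ nseq (n - size V) a) == n.
  by rewrite size_cat size_nseq subnKC.
have Vx : prefix V (Tuple xn) by rewrite /= prefix_prefix.
rewrite (path_labelE _ (labelling_code_prefix f) Vx) /=.
have -> : [seq label f (take (nat_of_ord i).+1 (V ++ nseq (n - size V) a)) | i <- enum 'I_n]
    = [seq label f (take i.+1 (V ++ nseq (n - size V) a)) | i <- iota 0 n].
  by rewrite -val_enum_ord -map_comp.
rewrite -map_take -map_drop take_iota drop_iota add0n (minn_idPl Vn).
rewrite /path_edges -map_comp; apply/eq_in_map => j; rewrite mem_iota => jV /=.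
by rewrite takel_cat //; lia.
Qed.

Definition edge_set (es : seq (seq Sin)) : {set n.-bseq Sin} :=
  [set x in map (@insub_bseq n Sin) es].

Lemma val_insub_bseq s : (size s <= n)%N -> insub_bseq n s = s :> seq Sin.
Proof. by move=> sn; rewrite -[LHS]/(val _) /insub_bseq val_insubd sn. Qed.

Lemma mem_edge_set (es : seq (seq Sin)) s :
  all (fun r => size r <= n)%N es -> (size s <= n)%N ->
  (insub_bseq n s \in edge_set es) = (s \in es).
Proof.
move=> /allP esn sn; rewrite inE; apply/mapP/idP => [[r rs e]|ss]; last by exists s.
by rewrite -(val_insub_bseq sn) e val_insub_bseq // esn.
Qed.

Lemma card_edge_set (es : seq (seq Sin)) :
  all (fun r => size r <= n)%N es -> uniq es -> #|edge_set es| = size es.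
Proof.
move=> /allP esn ues; rewrite cardsE -(size_map (@insub_bseq n Sin)); apply/card_uniqP.
rewrite map_inj_in_uniq // => r s /esn rn /esn sn /(congr1 (@bseqval n Sin)).
by rewrite !val_insub_bseq.
Qed.

End Labellings.

Lemma sum_pairE (M : nmodType) (I J : finType) (F : I * J -> M) :
  \sum_p F p = \sum_i \sum_j F (i, j).
Proof. by rewrite pair_bigA; apply: eq_bigr => -[]. Qed.

(** * Bad lambdas as events on labellings *)

Section BadLambdas.

Variables (R : realType) (n : nat) (Sin Sout : finType) (alpha : R).

(* The event [(A, (u, (v, w)))] describes the lambda with [B = A u], [D = B v]
   and [E = B w]; the bits carried by [u], [v] and [w] select the symbols of
   [AD] and [BE] that are matched with each other. *)
Notation edge := (n.-bseq Sin).
Notation word := (n.-bseq (Sin * bool)).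
Notation event := (edge * (word * (word * word)))%type.
Implicit Types (i : event) (f g : {ffun edge -> Sout}).

Definition evA i : seq Sin := i.1.
Definition evB i := evA i ++ unzip1 i.2.1.
Definition evD i := evB i ++ unzip1 i.2.2.1.
Definition evE i := evB i ++ unzip1 i.2.2.2.
Definition maskD i := unzip2 i.2.1 ++ unzip2 i.2.2.1.
Definition maskE i := unzip2 i.2.2.2.
Definition weight i := (size i.2.1 + (size i.2.2.1 + size i.2.2.2))%N.

(** Nonempty [v] and [w] express [B <> D] and [B <> E]. The last clause, with [weight i] equal to
    [|AD| + |BE|], is the length of common subsequence that a bad lambda forces. *)
Definition valid_event i : bool :=
  [&& size (evD i) <= n, size (evE i) <= n,
      0 < size i.2.2.1, 0 < size i.2.2.2 & `[< meet_at (evB i) (evD i) (evE i) >]]%N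
  && ((1 - alpha) * (weight i)%:R <= 4 * (count id (maskE i))%:R).

Definition event_supp i : {set edge} :=
  edge_set n (path_edges (evA i) (evD i) ++ path_edges (evB i) (evE i)).

Definition event_det i : {set edge} :=
  edge_set n (mask (maskE i) (path_edges (evB i) (evE i))).

Definition event_holds i f : bool :=
  mask (maskD i) (map (label f) (path_edges (evA i) (evD i))) ==
  mask (maskE i) (map (label f) (path_edges (evB i) (evE i))).

Lemma size_maskE i : size (maskE i) = size (path_edges (evB i) (evE i)).
Proof. by rewrite size_path_edges size_cat addKn !size_map. Qed.

Lemma all_size_path_edges U V : (size V <= n)%N ->
  all (fun s : seq Sin => size s <= n)%N (path_edges U V).
Proof.
move=> Vn; apply/allP => s /mem_path_edges[_ /andP[_ sV]].
exact: leq_trans sV Vn.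
Qed.

Lemma event_holds_supp i f g : {in event_supp i, f =1 g} ->
  event_holds i f -> event_holds i g.
Proof.
move=> fg; rewrite /event_holds; have lab U V :
    {subset path_edges U V <= path_edges (evA i) (evD i) ++ path_edges (evB i) (evE i)} ->
    map (label f) (path_edges U V) = map (label g) (path_edges U V).
  move=> sub; apply/eq_in_map => s /sub sUV; apply: fg.
  by rewrite inE; apply/mapP; exists s.
by rewrite !lab // => s; rewrite mem_cat => ->; rewrite ?orbT.
Qed.

(** [AD] shares no edge with [BE], so [f] and [g] agree on [AD]; the event copies these labels to
    the matched edges of [BE]. *)
Lemma event_holds_det i f g : valid_event i ->
  {in ~: event_det i, f =1 g} -> event_holds i f -> event_holds i g -> f = g.
Proof.
move=> /andP[/and5P[Dn En _ _ /asboolP meet] _] fg /eqP hf /eqP hg.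
have allE := all_size_path_edges (evB i) En.
have allM : all (fun s => size s <= n)%N (mask (maskE i) (path_edges (evB i) (evE i))).
  by apply/allP => s /mem_mask; apply: (allP allE).
have labD : map (label f) (path_edges (evA i) (evD i)) =
            map (label g) (path_edges (evA i) (evD i)).
  apply/eq_in_map => s sD; apply: fg; rewrite inE.
  rewrite mem_edge_set ?(allP (all_size_path_edges (evA i) Dn)) //.
  by apply: contra (path_edges_meet meet sD); apply: mem_mask.
move: hg; rewrite -labD hf -(map_mask (label f)) -(map_mask (label g)) => /eq_in_map lab.
apply/ffunP => x; have [xT|xT] := boolP (x \in event_det i); last first.
  by apply: fg; rewrite inE.
by move: xT; rewrite inE => /mapP[s sM ->]; apply: lab.
Qed.

Lemma card_event_det i : valid_event i -> #|event_det i| = count id (maskE i).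
Proof.
move=> /andP[/and5P[_ En _ _ _] _]; rewrite card_edge_set.
- by rewrite size_mask // size_maskE.
- apply/allP => s /mem_mask; exact: (allP (all_size_path_edges _ En)).
- by rewrite mask_uniq // path_edges_uniq.
Qed.

Lemma event_supp_neq0 i : valid_event i -> event_supp i != set0.
Proof.
move=> /andP[/and5P[_ _ v0 _ _] _]; apply/set0Pn.
case e: (path_edges (evA i) (evD i)) => [|s es].
  by move/(congr1 size): e; rewrite size_path_edges !size_cat !size_map /=; lia.
by exists (insub_bseq n s); rewrite inE e /= in_cons eqxx.
Qed.

(** Both paths stay below [A], within depth [weight i] of it. This confines [A] to the ancestors
    counted by [card_prefix_close]. *)
Lemma event_supp_close i (e : edge) : valid_event i -> e \in event_supp i ->
  prefix (evA i) e && (size e <= size (evA i) + weight i)%N.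
Proof.
move=> /andP[/and5P[Dn En _ _ _] _]; rewrite inE => /mapP[s + ->].
have le_prefix V : prefix (evA i) V -> prefix s V -> (size (evA i) < size s)%N ->
    prefix (evA i) s.
  rewrite !prefixE => /eqP AV /eqP <- /ltnW As.
  by move: As; rewrite size_take_min leq_min => /andP[As _]; rewrite take_takel // AV.
rewrite mem_cat => /orP[] /mem_path_edges[sV /andP[Us sV']].
  rewrite val_insub_bseq ?(leq_trans sV' Dn) //.
  rewrite (le_prefix _ _ sV) //=; last by rewrite /evD /evB -catA prefix_prefix.
    by apply: leq_trans sV' _; rewrite !size_cat !size_map /weight; lia.
rewrite val_insub_bseq ?(leq_trans sV' En) //.
rewrite (le_prefix _ _ sV) //=.
- by apply: leq_trans sV' _; rewrite !size_cat !size_map /weight; lia.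
- by rewrite /evE /evB -catA prefix_prefix.
- by apply: leq_ltn_trans Us; rewrite size_cat leq_addr.
Qed.

Lemma zip_bseq (U : seq Sin) (m : bitseq) : size m = size U -> (size U <= n)%N ->
  exists2 u : word, unzip1 u = U & unzip2 u = m.
Proof.
move=> sm Un; have zn : (size (zip U m) <= n)%N by rewrite size_zip sm minnn.
by exists (Bseq zn); rewrite /= ?unzip1_zip ?unzip2_zip ?sm.
Qed.

Lemma bad_lambda_event f (a : Sin) : alpha < 1 ->
  bad_lambda alpha (labelling_code f) ->
  exists2 i, valid_event i & event_holds i f.
Proof.
move=> a1 [A [B [D [E [[Dn En] [BD BE] meet pAB]]]]].
have [pBD pBE _] := meet.
rewrite !(path_label_code _ _ a) // /ED.
(* The minimum defining [ED] is attained, and an optimal matching provides the masks. *)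
case: ex_minnP => k /asboolP[tau1 [tau2 [/string_matching_masks]]].
move=> [m1 [m2 [s1 s2 em le]]] <- _.
move: s1 s2 le; rewrite !(size_map (label f)) !size_path_edges.
case/prefixP: pAB em pBD pBE meet BD BE => U -> em /prefixP[V eD] /prefixP[W eE] meet BD BE.
rewrite {}eD {}eE in Dn En em meet BD BE *.
rewrite !size_cat !addKn -!addnA addKn => s1 s2 le ED_le.
rewrite !size_cat in Dn En.
(* The mask of [AD] is cut at [B]: its first [size U] bits go to [u], the rest to [v]. *)
have [u u1 u2] : exists2 u : word, unzip1 u = U & unzip2 u = take (size U) m1.
  by apply: zip_bseq; [rewrite size_takel // s1 leq_addr | lia].
have [v v1 v2] : exists2 v : word, unzip1 v = V & unzip2 v = drop (size U) m1.
  by apply: zip_bseq; [rewrite size_drop s1 addKn | lia].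
have [w w1 w2] : exists2 w : word, unzip1 w = W & unzip2 w = m2.
  by apply: zip_bseq; [rewrite s2 | lia].
have [su sv sw] : [/\ size u = size U, size v = size V & size w = size W].
  by rewrite -u1 -v1 -w1 !size_map.
have An : (size A <= n)%N by lia.
exists (Bseq An, (u, (v, w))); last first.
  by rewrite /event_holds /maskD /maskE /evE /evD /evB /= u1 u2 v1 v2 w1 w2 cat_take_drop em.
rewrite /valid_event /weight /maskE /evE /evD /evB /= u1 v1 w1 w2 su sv sw.
rewrite !size_cat -!addnA in Dn En *.
apply/andP; split.
  apply/and5P; split=> //; last exact/asboolP.
  - by rewrite lt0n; apply/nilP => V0; case: BD; rewrite V0 cats0.
  - by rewrite lt0n; apply/nilP => W0; case: BE; rewrite W0 cats0.
(* With [m = maxn p r] and [l] matched pairs, [2 l >= p + r - alpha m >= (1 - alpha) m], and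
   [2 m >= p + r]. *)
set p := (size U + size V)%N in le ED_le *; set r := size W in le ED_le *.
have max_le : (maxn p r)%:R <= (p + r)%:R :> R by rewrite ler_nat; lia.
have max_ge : (p + r)%:R <= 2 * (maxn p r)%:R :> R by rewrite -natrM ler_nat; lia.
have : (p + r)%:R <= 2 * (count id m2)%:R + (sc tau1 + sc tau2)%:R :> R.
  by rewrite -natrM -natrD ler_nat; lia.
have le_max : (1 - alpha) * (p + r)%:R <= (1 - alpha) * (2 * (maxn p r)%:R).
  by rewrite ler_wpM2l // subr_ge0 ltW.
rewrite addnA -/p -/r; lra.
Qed.

(** * The local lemma condition for lambdas *)

Variable d : nat.
Hypotheses (Sin_card : #|Sin| = d) (d_gt0 : (0 < d)%N).
Hypothesis Sout_large : forall l s : nat, (1 - alpha) * s%:R <= 4 * l%:R ->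
  (88 * d%:R) ^+ s <= (2^-1 * #|Sout|%:R) ^+ l :> R.

(** An event of weight [s] contributes at most [(88 d)^-s], and for fixed [u], [v], [w] at most
    [2 ^ s] nodes [A] reach [e]. What remains is a product of three geometric series with letter
    weight [t]. *)
Lemma sum_events_le (e : edge) :
  \sum_(i | valid_event i && (e \in event_supp i))
     ((2^-1 * #|Sout|%:R)^-1) ^+ #|event_det i| <= 1 - 2^-1 :> R.
Proof.
have d0 : 0 < d%:R :> R by rewrite ltr0n.
pose b : R := 88 * d%:R; pose t : R := 2 / b.
have b0 : 0 < b by rewrite mulr_gt0.
have t0 : 0 <= t by rewrite divr_ge0 // ltW.
(* There are [2 d] letters of weight [2 / (88 d)], hence ratio 1/22. *)
have tx : #|{: Sin * bool}|%:R * t <= 22^-1.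
  by rewrite card_prod card_bool Sin_card natrM /t /b le_eqVlt; apply/orP; left; apply/eqP; field; lra.
have x1 : 22^-1 < 1 :> R by lra.
have S0 := sum_bseq_size_from n t0 tx x1 0.
have S1 := sum_bseq_size_from n t0 tx x1 1.
set S0' := \sum_(_ | _) _ in S0; set S1' := \sum_(_ | _) _ in S1.
have S1_0 : 0 <= S1' by apply: sumr_ge0 => u _; rewrite exprn_ge0.
have S0_0 : 0 <= S0' by apply: sumr_ge0 => u _; rewrite exprn_ge0.
apply: (@le_trans _ _ (S0' * (S1' * S1'))); last first.
  (* The series for [u] sums to at most 22/21; those for the nonempty [v] and [w] start at 1/22 and
     give 1/21 each. *)
  apply: (@le_trans _ _ (2 * (21^-1 * 21^-1))); last by lra.
  have S0_le : S0' <= 2.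
    by apply: le_trans S0 _; rewrite expr0 ler_pdivrMr; lra.
  have S1_le : S1' <= 21^-1.
    by apply: le_trans S1 _; rewrite expr1 ler_pdivrMr; lra.
  by apply: ler_pM (mulr_ge0 S1_0 S1_0) _ _ => //; apply: ler_pM.
pose Q i := [&& prefix (evA i) e, size e <= size (evA i) + weight i,
  0 < size i.2.2.1 & 0 < size i.2.2.2]%N.
apply: (@le_trans _ _ (\sum_(i | Q i) b^-1 ^+ weight i)).
  rewrite big_mkcond [leRHS]big_mkcond; apply: ler_sum => i _.
  case: ifP => [/andP[vi ei]|_]; last first.
    by case: ifP => // _; rewrite exprn_ge0 // invr_ge0 ltW.
  have /andP[pA le] := event_supp_close vi ei.
  rewrite /Q pA le /=; have /andP[/and5P[_ _ -> -> _] hw] := vi.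
  have hl := Sout_large hw; have hb := exprn_gt0 (weight i) b0.
  by rewrite (card_event_det vi) !exprVn lef_pV2 ?posrE // (lt_le_trans hb).
(* The sum over [A] is moved innermost, to be bounded for fixed [u], [v], [w]. *)
rewrite big_mkcond sum_pairE exchange_big sum_pairE /=.
rewrite /S0' mulr_suml; apply: ler_sum => u _; rewrite sum_pairE.
rewrite mulrC /S1' !mulr_suml [leRHS]big_mkcond; apply: ler_sum => v _ /=.
rewrite mulrAC mulr_sumr.
have [v0|v0] := ltnP 0 (size v); last first.
  by rewrite big1 // => w _; rewrite big1 // => A _; rewrite /Q /= ltnNge v0 /= !andbF.
rewrite [leRHS]big_mkcond; apply: ler_sum => w _ /=.
have [w0|w0] := ltnP 0 (size w); last first.
  by rewrite big1 // => A _; rewrite /Q /= (ltnNge 0 (size w)) w0 /= !andbF.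
rewrite -big_mkcond /= /weight /= sumr_const -[_ *+ _]mulr_natl.
rewrite -!exprD -[(_ + size u + _)%N]addnAC [(_ + size u)%N]addnC.
set s := (size u + _)%N.
apply: (@le_trans _ _ ((2 ^ s)%N%:R * b^-1 ^+ s)).
  apply: ler_wpM2r; first by rewrite exprn_ge0 // invr_ge0 ltW.
  rewrite ler_nat (leq_trans _ (card_prefix_close n e s)) //.
  by apply/subset_leq_card/subsetP => A; rewrite !inE /Q => /and4P[-> -> _ _].
by rewrite natrX -exprMn.
Qed.

End BadLambdas.

(** * Existence of the tree code *)

Theorem theorem5 (R : realType) (d n : nat) (alpha : R)
    (hd : (2 <= d)%N) (hn : (0 < n)%N) (halpha : 0 < alpha < 1) :
  exists (Sin Sout : finType) (C : n.-tuple Sin -> n.-tuple Sout),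
    [/\ #|Sin| = d,
        #|Sout| = Num.truncn ((176 * d%:R) `^ (4 / (1 - alpha)) : R)
      & edit_distance_tree_code alpha C].
Proof.
have d_gt0 : (0 < d)%N by apply: ltnW.
have [_ a1] := andP halpha.
set q := Num.truncn _.
have large l s : (1 - alpha) * s%:R <= 4 * l%:R ->
    (88 * d%:R) ^+ s <= (2^-1 * #|'I_q|%:R) ^+ l :> R.
  by rewrite card_ord; apply: powR_truncn_le.
have q_gt0 : (0 < #|'I_q|)%N.
  (* For [q = 0], the bound at [l = s = 1] would read [88 d <= 0]. *)
  rewrite lt0n; apply/eqP => q0; have := large 1 1%N; rewrite q0 mulr0 !expr1.
  have : 1 <= d%:R :> R by rewrite ler1n.
  have [a0 _] := andP halpha; lra.
have [f fP] : exists f : {ffun n.-bseq 'I_d -> 'I_q},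
    forall i, valid_event alpha i -> ~~ event_holds i f.
  apply: (@exists_avoiding R _ _ _ _ (@event_supp n 'I_d) (@event_det n 'I_d)
    (@event_holds n 'I_d 'I_q) _ _ 2^-1).
  - by move=> i f g _; apply: event_holds_supp.
  - exact: event_holds_det.
  - lra.
  - exact: q_gt0.
  - exact: (sum_events_le (card_ord d) d_gt0 large).
  - exact: event_supp_neq0.
exists 'I_d, 'I_q, (labelling_code f); split; rewrite ?card_ord //.
split; first exact: labelling_code_prefix.
move=> /(bad_lambda_event (Ordinal d_gt0) a1)[i vi].
by apply/negP/fP.
Qed.
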